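(* Let $p$ be a prime and let $G$ be a finite $p$-group. Then $S(G)_{\rm prime} \subset S(G/G')$.
   Context: For a finite group $G$, let $x_{g}$ be a variable for each $g \in G$. The group determinant of $G$ is $\Theta_{G}(x_{g}) := \det (x_{g h^{-1}})_{g, h \in G} \in \mathbb{Z}[x_{g}]$, and the set of integer group determinants of $G$ is $S(G) := \{ \Theta_{G}(a_{g}) \mid a_{g} \in \mathbb{Z} \text{ for all } g \in G \}$. Put $S(G)_{\rm prime} := \{ m \in S(G) \mid m \text{ is a prime} \}$ (primes are positive). $G'$ denotes the commutator subgroup of $G$, so $G/G'$ is the abelianization of $G$. *)

(* Defs.v *)
From HB Require Import structures.
From mathcomp Require Import all_boot all_order all_algebra.
From mathcomp Require Import all_fingroup all_solvable.
From mathcomp Require Import mpoly.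

Set Implicit Arguments.
Unset Strict Implicit.
Unset Printing Implicit Defensive.

Import GRing.Theory.
Local Open Scope ring_scope.

(* Rows and columns are indexed by the enumeration [enum_val] of [G]; the
   determinant does not depend on the enumeration, since the same one is used
   for both. *)
Definition group_mx (gT : finGroupType) (G : {group gT}) (R : comNzRingType)
    (x : gT -> R) : 'M[R]_#|G| :=
  \matrix_(i, j) x (enum_val i * (enum_val j)^-1)%g.

(* The variable x_g is ['X_i] with [i] the rank of [g] in [G]. *)
Definition group_det (gT : finGroupType) (G : {group gT}) :
    {mpoly int[#|G|]} :=
  \det (group_mx G (fun g => 'X_(enum_rank_in (group1 G) g))).

(* S(G), as a predicate on [int]; only the values of [a] on [G] matter. *)
Definition int_group_det (gT : finGroupType) (G : {group gT}) (m : int) : Prop :=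
  exists a : gT -> int, m = (group_det G).@[fun i => a (enum_val i)].

Definition int_group_det_prime (gT : finGroupType) (G : {group gT}) (m : int) :
    Prop :=
  int_group_det G m /\ exists2 q : nat, prime q & m = q%:Z.

Lemma group_det_eval (gT : finGroupType) (G : {group gT}) (a : gT -> int) :
  (group_det G).@[fun i => a (enum_val i)] = \det (group_mx G a).
Proof.
rewrite /group_det -det_map_mx; congr (\det _); apply/matrixP => i j.
by rewrite !mxE /= mevalXU enum_rankK_in // groupM ?groupV ?enum_valP.
Qed.

(* Main.v *)
Require Import Defs.
From mathcomp Require Import all_boot all_order all_algebra.
From mathcomp Require Import all_fingroup all_solvable.
From mathcomp Require Import all_field all_character.

(** Let [a] be an integer vector on the [p]-group [G], and let [b] be its
    pushforward to [G / G'], i.e. the vector of its coset sums.  The group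
    matrix of [a] is the action of the group algebra element
    [\sum_x a x *: x] on the left regular representation, which splits as the
    sum of the irreducible representations, each repeated as often as its degree.  Taking
    characteristic polynomials, the factors of the linear characters multiply
    up to the characteristic polynomial for [b] on [G / G'], while each other
    degree is a nontrivial power of [p], so that
      [char_poly (G, a) = char_poly (G / G', b) * g ^+ p]
    with [g] monic over the algebraic numbers.

    The point is that [g] is rational: a monic [p]-th root of a rational
    polynomial is determined by it through rational operations, coefficient by
    coefficient ([monic_root_polyOver]).  This replaces an orbit argument under
    the Galois group.  The constant coefficient [c] of [g] is moreover an
    algebraic integer, hence an integer, and evaluating at 0 gives
      [Theta_G (a) = Theta_(G / G') (b) * c ^+ p]
    ([det_group_mx_der1], where [a] is first negated so that the signs of the
    constant coefficients disappear).

    If the left hand side is prime then [c] is 1 or -1, as [p > 1].  So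
    [Theta_(G / G')] takes the required value at [b] unless [c] is -1 and [p] is
    odd; the order of [G / G'] is then odd, and the value is taken at [- b]. *)

Set Implicit Arguments.
Unset Strict Implicit.
Unset Printing Implicit Defensive.

Import GRing.Theory Num.Theory.
Local Open Scope ring_scope.

(** * Monic roots of polynomials over a subfield *)

Lemma size_sub_lead (R : nzRingType) (p q : {poly R}) :
  p != 0 -> size q = size p -> lead_coef q = lead_coef p ->
  (size (p - q)%R < size p)%N.
Proof.
move=> nz_p sz_q lead_q; have gt0 : (0 < size p)%N by rewrite size_poly_gt0.
rewrite -[ltnRHS]prednK // ltnS; apply/leq_sizeP=> j.
rewrite leq_eqVlt => /orP[/eqP<-|lt_j].
  by rewrite coefB -lead_coefE -[in X in _ - X]sz_q -lead_coefE lead_q subrr.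
have le_j : (size p <= j)%N by rewrite -[size p]prednK.
by rewrite coefB !nth_default ?subrr // sz_q.
Qed.

(** In [p ^+ n - q ^+ n = (p - q) * \sum_i p ^+ (n.-1 - i) * q ^+ i] the [n]
    summands are monic of the same size, so the sum has leading coefficient
    [n]. *)
Lemma lead_coef_subXX (R : idomainType) (n : nat) (p q : {poly R}) :
  n%:R != 0 :> R -> p \is monic -> q \is monic -> size q = size p ->
  lead_coef (p ^+ n - q ^+ n) = lead_coef (p - q) * n%:R.
Proof.
move=> nz_n mon_p mon_q sz_q; rewrite subrXX lead_coefM; congr (_ * _).
set s := \sum_(i < n) _; pose d := ((size p).-1 * n.-1)%N.
have mon_t (i : 'I_n) : let t := p ^+ (n.-1 - i) * q ^+ i in
    t \is monic /\ size t = d.+1.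
  split=> [|/=]; first by rewrite monicMl ?monic_exp.
  rewrite size_monicM ?monic_exp ?monic_neq0 ?monic_exp //.
  rewrite -[size (p ^+ _)]prednK ?size_poly_gt0 ?monic_neq0 ?monic_exp //.
  rewrite -[size (q ^+ _)]prednK ?size_poly_gt0 ?monic_neq0 ?monic_exp //.
  rewrite addSn addnS /= !size_exp sz_q -mulnDr subnK //.
  by rewrite -ltnS prednK ?ltn_ord // (leq_ltn_trans _ (ltn_ord i)).
have s_d : s`_d = n%:R.
  rewrite coef_sum -[n in RHS]card_ord -sum1_card natr_sum.
  apply: eq_bigr => i _; have [/monicP + sz] := mon_t i.
  by rewrite lead_coefE sz.
rewrite lead_coefE; suffices -> : size s = d.+1 by [].
apply/eqP; rewrite eqn_leq; apply/andP; split.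
  apply: (leq_trans (size_sum _ _ _)); apply/bigmax_leqP=> i _.
  by have [_ ->] := mon_t i.
rewrite ltnNge; apply: contra nz_n => /leq_sizeP/(_ _ (leqnn d)).
by rewrite s_d => ->.
Qed.

(** Approximate [g] by a monic [u] of the same size over [S], starting from a
    power of the variable.  The leading coefficient of [g - u] can be read off
    from that of [f * g ^+ n - f * u ^+ n], which is over [S], so that the next
    term of [g] is over [S] too and can be added to [u]. *)
Lemma monic_root_polyOver (F : fieldType) (S : divringClosed F) (n : nat)
    (f g : {poly F}) :
  n%:R != 0 :> F -> f != 0 -> f \is a polyOver S -> g \is monic ->
  f * g ^+ n \is a polyOver S -> g \is a polyOver S.
Proof.
move=> nz_n nz_f Sf mon_g Sfgn.
have approx k u : u \is monic -> size u = size g -> u \is a polyOver S ->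
    (size (g - u)%R <= k)%N -> g \is a polyOver S.
  elim: k u => [|k IHk] u mon_u sz_u Su.
    by rewrite size_poly_leq0 subr_eq0 => /eqP->.
  have [->//|neq_gu] := eqVneq g u.
  set h := g - u; have nz_h : h != 0 by rewrite subr_eq0.
  have lead_diff : lead_coef (f * (g ^+ n - u ^+ n))
      = lead_coef f * (lead_coef h * n%:R).
    by rewrite lead_coefM lead_coef_subXX.
  have Sh : lead_coef h \in S.
    have -> : lead_coef h
        = lead_coef (f * g ^+ n - f * u ^+ n) / (lead_coef f * n%:R).
      by rewrite -mulrBr lead_diff mulrCA mulfK // mulf_neq0 ?lead_coef_eq0.
    have SL q : q \is a polyOver S -> lead_coef q \in S.
      by move/polyOverP; apply.
    apply: rpred_div; last by rewrite rpredM ?rpred_nat ?SL.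
    by apply: SL; rewrite rpredB // rpredM // rpredX.
  move=> sz_h.
  pose t := lead_coef h *: 'X^((size h).-1).
  have sz_t : size t = size h.
    by rewrite size_scale ?lead_coef_eq0 // size_polyXn prednK // size_poly_gt0.
  have lt_tu : (size t < size u)%N.
    by rewrite sz_t sz_u size_sub_lead ?monic_neq0 // !(monicP _).
  apply: (IHk (u + t)).
  - by rewrite monicE lead_coefDl // (monicP mon_u).
  - by rewrite size_polyDl.
  - by rewrite rpredD // polyOverZ // rpredX // polyOverX.
  rewrite opprD addrA -/h -ltnS; apply: leq_trans sz_h.
  by rewrite size_sub_lead // lead_coefZ lead_coefXn mulr1.
have gt0 : (0 < size g)%N by rewrite size_poly_gt0 monic_neq0.
apply: (approx (size (g - 'X^((size g).-1))%R) 'X^((size g).-1)) => //.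
- exact: monicXn.
- by rewrite size_polyXn prednK.
by rewrite rpredX // polyOverX.
Qed.

(** * Characteristic polynomials of group algebra elements *)

Section GroupAlgebraAction.

Variables (F : fieldType) (gT : finGroupType) (G : {group gT}).
Implicit Types a : gT -> F.

Definition repr_lin n (rG : mx_representation F G n) a : 'M[F]_n :=
  \sum_(x in G) a x *: rG x.

Lemma char_poly_rsim n1 n2 (rG1 : mx_representation F G n1)
    (rG2 : mx_representation F G n2) a :
  mx_rsim rG1 rG2 -> char_poly (repr_lin rG1 a) = char_poly (repr_lin rG2 a).
Proof.
case=> B def_n1; rewrite {n1}def_n1 in rG1 B *.
rewrite row_free_unit => uB rG_B.
have linB : repr_lin rG1 a *m B = B *m repr_lin rG2 a.
  rewrite mulmx_suml mulmx_sumr; apply: eq_bigr => x Gx.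
  by rewrite -scalemxAl rG_B // scalemxAr.
have uPB : \det (map_mx polyC B) != 0.
  by rewrite det_map_mx polyC_eq0 -unitfE -unitmxE.
apply: (mulIf uPB); rewrite [RHS]mulrC -!det_mulmx; congr (\det _).
rewrite /char_poly_mx mulmxBl mulmxBr -!map_mxM /= linB.
by rewrite mul_scalar_mx mul_mx_scalar.
Qed.

Lemma char_poly_dadd (rU rV : representation F G) a :
  char_poly (repr_lin (dadd_grepr rU rV) a)
    = char_poly (repr_lin rU a) * char_poly (repr_lin rV a).
Proof.
have -> : repr_lin (dadd_grepr rU rV) a
    = block_mx (repr_lin rU a) 0 0 (repr_lin rV a).
  rewrite /repr_lin; elim/big_rec3: _ => [|x B C D Gx ->].
    by rewrite block_mx0.
  by rewrite scale_block_mx !scaler0 add_block_mx !addr0.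
by rewrite /char_poly char_block_diag_mx det_ublock.
Qed.

Lemma char_poly_dsum I (r : seq I) (P : pred I)
    (rW : I -> representation F G) a :
  char_poly (repr_lin (\big[@dadd_grepr _ _ _/grepr0]_(i <- r | P i) rW i) a)
    = \prod_(i <- r | P i) char_poly (repr_lin (rW i) a).
Proof.
elim/big_rec2: _ => [|i p rV _ <-]; first by rewrite /char_poly det_mx00.
exact: char_poly_dadd.
Qed.

(** The group matrix of the indicator of [x] permutes the basis [G] as left
    multiplication by [x] does.  Since [regular_repr] acts on the right, its
    operators are not group matrices on the nose; for this left variant
    [group_mx G a] is literally the action of the group algebra element [a]. *)
Lemma left_regular_repr_subproof :
  mx_repr G (fun x => group_mx G (fun g => (g == x)%:R : F)).
Proof.
split=> [|x y Gx Gy]; apply/matrixP=> i j; rewrite !mxE.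
  by rewrite -eq_mulgV1 (inj_eq enum_val_inj).
have Gyj : (y * enum_val j)%g \in G by rewrite groupM ?enum_valP.
rewrite (bigD1 (enum_rank_in (group1 G) (y * enum_val j)%g)) //= big1 ?addr0.
  rewrite !mxE enum_rankK_in // mulgK eqxx mulr1 invMg mulgA.
  congr (nat_of_bool _)%:R.
  by rewrite -[RHS](inj_eq (mulIg y)) mulgKV.
move=> k ne_k; rewrite !mxE [X in _ * X](_ : _ = 0) ?mulr0 //.
case: eqP => // def_y; case/eqP: ne_k; apply: enum_val_inj.
by rewrite enum_rankK_in // -def_y mulgKV.
Qed.

Definition left_regular_repr := MxRepresentation left_regular_repr_subproof.

Lemma repr_lin_left_regular a :
  repr_lin left_regular_repr a = group_mx G a.
Proof.
apply/matrixP=> i j; rewrite summxE mxE.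
have Gij : (enum_val i * (enum_val j)^-1)%g \in G.
  by rewrite groupM ?groupV ?enum_valP.
rewrite (bigD1 _ Gij) /= big1 ?addr0 => [|x /andP[_ ne_x]].
  by rewrite !mxE eqxx mulr1.
by rewrite !mxE eq_sym (negPf ne_x) mulr0.
Qed.

End GroupAlgebraAction.

Lemma cfRepr_left_regular (gT : finGroupType) (G : {group gT}) :
  cfRepr (left_regular_repr algC G) = cfReg G.
Proof.
apply/cfun_inP=> x Gx; rewrite cfRegE cfunE Gx /mxtrace.
rewrite (eq_bigr (fun=> (x == 1%g)%:R)) => [|i _]; last first.
  by rewrite mxE mulgV eq_sym.
rewrite sumr_const card_ord.
by case: (x == 1%g); rewrite /= ?mul0rn ?mulr0n ?mulr1n.
Qed.

(** * Splitting off the linear characters *)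

(** Similarity with the direct sum of the irreducible representations comes for
    free from the equality of the characters. *)
Lemma char_poly_group_mx (gT : finGroupType) (G : {group gT}) (a : gT -> algC) :
  char_poly (group_mx G a) =
    \prod_(i : Iirr G)
      char_poly (repr_lin 'Chi_i a) ^+ irr_degree (socle_of_Iirr i).
Proof.
rewrite -repr_lin_left_regular.
pose rV := \big[@dadd_grepr _ _ _/grepr0]_(i : Iirr G)
  muln_grepr (Representation 'Chi_i) (irr_degree (socle_of_Iirr i)).
have sim : mx_rsim (left_regular_repr algC G) rV.
  apply: cfRepr_inj; rewrite cfRepr_left_regular cfReg_sum cfRepr_dsum.
  by apply: eq_bigr => i _; rewrite cfRepr_muln irrRepr irr1_degree scaler_nat.
rewrite (char_poly_rsim _ sim) char_poly_dsum; apply: eq_bigr => i _.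
by rewrite char_poly_dsum prodr_const card_ord.
Qed.

Lemma char_poly_degree1 (gT : finGroupType) (G : {group gT}) n
    (rG : mx_representation algC G n) (a : gT -> algC) :
  n = 1%N ->
  char_poly (repr_lin rG a) = 'X - (\sum_(x in G) a x * cfRepr rG x)%:P.
Proof.
move=> n1; rewrite {n}n1 in rG *.
rewrite /char_poly det_mx11 !mxE eqxx mulr1n summxE; congr (_ - _%:P).
by apply: eq_bigr => x Gx; rewrite mxE cfunE Gx trace_mx11.
Qed.

Lemma char_poly_linear (gT : finGroupType) (G : {group gT}) (i : Iirr G)
    (a : gT -> algC) :
  'chi_i \is a linear_char ->
  char_poly (repr_lin 'Chi_i a) ^+ irr_degree (socle_of_Iirr i)
    = 'X - (\sum_(x in G) a x * 'chi_i x)%:P.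
Proof.
move=> /andP[_]; rewrite irr1_degree pnatr_eq1 => /eqP n1.
by rewrite char_poly_degree1 // irrRepr n1.
Qed.

(** The image of a group algebra element of [G] in the group algebra of
    [G / H]. *)
Definition coset_sum (gT : finGroupType) (G H : {group gT}) (V : nmodType)
    (a : gT -> V) (y : coset_of H) : V :=
  \sum_(x in G | coset H x == y) a x.

(** The irreducible characters of the abelian group [G / G'] are the linear
    characters of [G], and a linear character takes the same value on a group
    algebra element and on its image. *)
Lemma char_poly_abelianization (gT : finGroupType) (G : {group gT})
    (a : gT -> algC) :
  char_poly (group_mx (G / G^`(1))%G (coset_sum G a)) =
    \prod_(i | 'chi[G]_i \is a linear_char)
      char_poly (repr_lin 'Chi_i a) ^+ irr_degree (socle_of_Iirr i).
Proof.
have nsG'G := der_normal 1 G.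
rewrite char_poly_group_mx (eq_bigl _ _ (@lin_irr_der1 _ G)).
rewrite (reindex _ (mod_Iirr_bij nsG'G)) /=.
apply: eq_big => [j|j _]; first by rewrite mod_IirrE // cfker_mod.
have linG' : 'chi_(mod_Iirr j) \is a linear_char.
  by rewrite lin_irr_der1 mod_IirrE // cfker_mod.
rewrite char_poly_linear; last exact/char_abelianP/der_abelian.
rewrite char_poly_linear //; congr (_ - _%:P); rewrite mod_IirrE //.
under eq_bigr do rewrite /coset_sum mulr_suml.
rewrite (exchange_big_dep (mem G)) /= => [|y x _ /andP[]//].
apply: eq_bigr => x Gx; rewrite cfModE // (big_pred1 (coset G^`(1) x)) // => y.
by rewrite /= Gx /= eq_sym; case: eqP => [->|]; rewrite ?andbF // mem_quotient.
Qed.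

Lemma char_poly_group_mx_der1 (gT : finGroupType) (G : {group gT})
    (a : gT -> algC) :
  char_poly (group_mx G a) =
    char_poly (group_mx (G / G^`(1))%G (coset_sum G a)) *
    \prod_(i | 'chi[G]_i \isn't a linear_char)
      char_poly (repr_lin 'Chi_i a) ^+ irr_degree (socle_of_Iirr i).
Proof.
by rewrite char_poly_abelianization char_poly_group_mx
  (bigID (fun i => 'chi[G]_i \is a linear_char)).
Qed.

(** The degree of an irreducible character divides the order of the group, so
    here it is a power of [p]. *)
Lemma dvdn_pgroup_irr_degree (p : nat) (gT : finGroupType) (G : {group gT})
    (i : Iirr G) :
  (p.-group G)%g -> 'chi_i \isn't a linear_char ->
  (p %| irr_degree (socle_of_Iirr i))%N.
Proof.
move=> pG; rewrite qualifE /= irr_char irr1_degree pnatr_eq1.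
have: (irr_degree (socle_of_Iirr i) %| #|G|)%N.
  by have:= dvd_irr1_cardG i; rewrite irr1_degree dvdC_nat.
move/pnat_dvd/(_ pG)/p_natP=> [[|k] ->] // _.
exact: dvdn_exp.
Qed.

(** The [p]-th power is that of the constant coefficient of the polynomial [g]
    below, in which each nonlinear irreducible representation contributes with
    exponent its degree divided by [p]. *)
Lemma det_group_mx_der1 (p : nat) (gT : finGroupType) (G : {group gT})
    (a : gT -> int) :
  prime p -> (p.-group G)%g ->
  exists c : int,
    \det (group_mx G a) =
      \det (group_mx (G / G^`(1))%G (coset_sum G a)) * c ^+ p.
Proof.
(* The constant coefficient of the characteristic polynomial of a matrix is the
   determinant of the opposite matrix, hence the passage to [- a]. *)
move=> p_pr pG; pose na x := - a x; pose nac x : algC := (na x)%:~R.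
have map_group (hT : finGroupType) (H : {group hT}) (b : hT -> int) c :
    (forall x, c x = (b x)%:~R) ->
    char_poly (group_mx H c)
      = map_poly intr (char_poly (group_mx H b)) :> {poly algC}.
  move=> def_c; rewrite map_char_poly; congr char_poly.
  by apply/matrixP=> i j; rewrite !mxE def_c.
have det_na (hT : finGroupType) (H : {group hT}) (b c : hT -> int) :
    (forall x, c x = - b x) ->
    (char_poly (group_mx H c)).[0] = \det (group_mx H b).
  move=> def_c; rewrite horner_coef0 char_poly_det -detZ; congr (\det _).
  by apply/matrixP=> i j; rewrite !mxE def_c mulN1r opprK.
pose f := char_poly (group_mx (G / G^`(1))%G (coset_sum G na)).
pose h := char_poly (group_mx G na).
pose g := \prod_(i | 'chi[G]_i \isn't a linear_char)
      char_poly (repr_lin 'Chi_i nac) ^+ (irr_degree (socle_of_Iirr i) %/ p).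
have mon_g : g \is monic.
  by apply: monic_prod => i _; rewrite monic_exp // char_poly_monic.
have def_h : map_poly intr h = map_poly intr f * g ^+ p.
  rewrite -(map_group _ _ _ nac) // char_poly_group_mx_der1; congr (_ * _).
    by apply: map_group => y; rewrite rmorph_sum.
  rewrite -prodrXl; apply: eq_bigr => i nl_i.
  by rewrite -exprM divnK // (dvdn_pgroup_irr_degree pG).
have mon_f : map_poly intr f \is @monic algC.
  exact: monic_map (char_poly_monic _).
have over_Q (q : {poly int}) : map_poly intr q \is a polyOver Crat.
  by apply/polyOverP=> k; rewrite coef_map rpred_int.
have g_Q : g \is a polyOver Crat.
  apply: (@monic_root_polyOver _ _ p (map_poly intr f)) => //.
  - by rewrite pnatr_eq0 -lt0n prime_gt0.
  - exact: monic_neq0.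
  - by rewrite -def_h.
have g0_int : g.[0] \in Num.int.
  apply: Cint_rat_Aint; first by rewrite horner_coef0 (polyOverP g_Q).
  (* Up to sign [g.[0]] is the product of the roots of [g], which are roots of
     the monic integer polynomial [h]. *)
  have [r def_g] := closed_field_poly_normal g.
  rewrite def_g (monicP mon_g) scale1r horner_prod big_seq.
  apply: rpred_prod => z rz.
  rewrite !hornerE rpredN; apply: (@root_monic_Aint (map_poly intr h)) => //.
  - rewrite def_h rootE hornerM horner_exp.
    suffices /rootP-> : root g z.
      by rewrite expr0n (gtn_eqF (prime_gt0 p_pr)) mulr0.
    by rewrite def_g (monicP mon_g) scale1r root_prod_XsubC.
  - exact: monic_map (char_poly_monic _).
  - by apply/polyOverP=> k; rewrite coef_map rpred_int.
have [c def_c] := intrP g0_int.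
exists c; apply: (@intr_inj algC); rewrite rmorphM rmorphXn /= -def_c.
rewrite -(det_na _ G a na) // -(det_na _ _ _ (coset_sum G na)); last first.
  by move=> y; rewrite /coset_sum sumrN.
have /(congr1 (fun q => q.[0])) := def_h.
by rewrite hornerM horner_exp !horner_coef0 !coef_map.
Qed.

(** * Prime values *)

Lemma prime_mul_expn (n q u c : nat) :
  (1 < n)%N -> prime q -> q = (u * c ^ n)%N -> c = 1%N.
Proof.
move=> n_gt1 q_pr def_q.
have q_gt0 := prime_gt0 q_pr.
have c_dvd : (c %| q)%N by rewrite def_q dvdn_mull // dvdn_exp // ltnW.
case/primeP: (q_pr) => q_gt1 /(_ c c_dvd)/orP[/eqP-> //|/eqP eq_c].
have: (q ^ 2 %| q)%N by rewrite {2}def_q eq_c dvdn_mull // dvdn_exp2l.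
by move/(dvdn_leq q_gt0); rewrite -{2}(expn1 q) leq_exp2l.
Qed.

Theorem corollary4 (p : nat) (p_prime : prime p) (gT : finGroupType)
    (G : {group gT}) (pG : (p.-group G)%g) (m : int) :
  int_group_det_prime G m -> int_group_det (G / G^`(1))%G m.
Proof.
move=> [[a]]; rewrite group_det_eval => -> [q q_pr def_q].
have [c det_c] := det_group_mx_der1 a p_prime pG.
set b := coset_sum G a in det_c.
have c1 : `|c|%N = 1%N.
  apply: (@prime_mul_expn p q `|\det (group_mx (G / G^`(1))%G b)|%N) => //.
    exact: prime_gt1.
  by rewrite -abszX -abszM -det_c def_q.
have [c_1|c_N1] : c = 1 \/ c = -1.
- by case: c c1 {det_c} => [[|[]]|[]] //; [left | right].
- by exists b; rewrite group_det_eval det_c c_1 expr1n mulr1.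
rewrite det_c c_N1; have [->|p_odd] := even_prime p_prime.
  by exists b; rewrite group_det_eval sqrrN expr1n mulr1.
(* The order of [G / G'] is odd, so negating the vector changes the sign. *)
pose nb y := - b y.
exists nb; rewrite group_det_eval -signr_odd p_odd expr1 mulrN1.
have -> : group_mx (G / G^`(1))%G nb = -1 *: group_mx _ b.
  by apply/matrixP=> i j; rewrite !mxE mulN1r.
rewrite detZ.
have : odd #|(G / G^`(1))%G|.
  have := quotient_pgroup G^`(1) pG; rewrite /pgroup.
  case/p_natP=> k ->; by rewrite oddX p_odd orbT.
by move=> oddG; rewrite -signr_odd oddG expr1 mulN1r.
Qed.
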